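(* Let $X$ be a reflexive complex Banach space and let $a$ be a positive, densely defined linear operator from $X$ to $X^\ast$ with positive lower bound, i.e. $(ax,x)\ge\gamma\|x\|^2$ for all $x\in\operatorname{dom}a$, for some $\gamma>0$. Then $a$ admits a positive self-adjoint extension $A$ from $X$ to $X^\ast$ with the same lower bound, i.e. $(Ax,x)\ge\gamma\|x\|^2$ for all $x\in\operatorname{dom}A$.
   Context: $X^\ast$ denotes the conjugate dual of $X$: the space of all continuous conjugate-linear functionals on $X$; $X$ is identified with $X^{\ast\ast}$. For $v\in X^\ast$, $x\in X$ write $(v,x):=v(x)$ and $(x,v):=\overline{v(x)}$. For a densely defined linear operator $A$ from $X$ to $X^\ast$: $A$ is positive if $(Ax,x)\ge 0$ for all $x\in\operatorname{dom}A$; the adjoint $A^\ast$ is the operator from $X$ to $X^\ast$ with $\operatorname{dom}A^\ast=\{y\in X: x\mapsto (Ax,y)\text{ is continuous on }\operatorname{dom}A\}$ and $A^\ast y\in X^\ast$ determined by $(x,A^\ast y)=(Ax,y)$ for all $x\in\operatorname{dom}A$; $A$ is self-adjoint if $A=A^\ast$. *)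

(* Defs.v *)
From HB Require Import structures.
From mathcomp Require Import all_boot all_order all_algebra.
From mathcomp Require Import all_classical all_reals all_analysis.
From mathcomp Require Import complex.
Set Implicit Arguments. Unset Strict Implicit. Unset Printing Implicit Defensive.
Import Order.TTheory GRing.Theory Num.Theory.
Import numFieldTopology.Exports numFieldNormedType.Exports.
Local Open Scope classical_set_scope.
Local Open Scope ring_scope.
Local Open Scope complex_scope.

(* The usual (modulus) metric topology on the complex numbers R[i]. *)
HB.instance Definition _ (R : rcfType) :=
  PseudoPointedMetric.copy R[i] (R[i] : numFieldType)^o.

Section Defs.
Variables (R : realType) (X : completeNormedModType R[i]).

Definition conjlin (f : X -> R[i]) : Prop :=
  forall (a : R[i]) (x y : X), f (a *: x + y) = a^* * f x + f y.

(* elements of the conjugate dual X^* : continuous conjugate-linear functionals;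
   (v, x) := v x *)
Definition dual_elem (v : X -> R[i]) : Prop := conjlin v /\ continuous v.

(* elements of X^** : continuous (= bounded w.r.t. the dual norm
   ||v|| = inf {c >= 0 | forall x, |v x| <= c ||x||}) conjugate-linear
   functionals on X^* (with (a v + w) x = a * v x + w x). *)
Definition bidual_elem (F : (X -> R[i]) -> R[i]) : Prop :=
  (forall (a : R[i]) (v w : X -> R[i]), dual_elem v -> dual_elem w ->
      F (fun x => a * v x + w x) = a^* * F v + F w) /\
  exists M : R, forall (v : X -> R[i]) (c : R), dual_elem v -> 0 <= c ->
      (forall x, `|v x| <= c%:C * `|x|) -> `|F v| <= M%:C * c%:C.

(* reflexivity: the canonical embedding x |-> (v |-> (x, v) = conj (v x))
   of X into X^** is onto. *)
Definition reflexive_space : Prop :=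
  forall F, bidual_elem F -> exists x : X, forall v, dual_elem v -> F v = (v x)^*.

(* A linear operator from X to X^* with domain D is a pair (D, A) with
   A : X -> (X -> R[i]); only the values A x for x in D are meaningful. *)
Definition linear_subspace (D : set X) : Prop :=
  D 0 /\ forall (a : R[i]) x y, D x -> D y -> D (a *: x + y).

Definition dd_operator (D : set X) (A : X -> X -> R[i]) : Prop :=
  [/\ linear_subspace D, dense D,
      (forall (a : R[i]) x y, D x -> D y ->
         A (a *: x + y) = (fun z => a * A x z + A y z)) &
      (forall x, D x -> dual_elem (A x))].

Definition positive_op (D : set X) (A : X -> X -> R[i]) : Prop :=
  forall x, D x -> 0 <= A x x.

Definition lower_bound (gamma : R) (D : set X) (A : X -> X -> R[i]) : Prop :=
  forall x, D x -> gamma%:C * `|x| ^+ 2 <= A x x.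

(* (D', B) is the adjoint of (D, A): dom = {y | x |-> (Ax, y) continuous on D},
   and (x, B y) = conj (B y x) = (A x, y) = A x y for x in D. *)
Definition is_adjoint (D : set X) (A : X -> X -> R[i])
    (D' : set X) (B : X -> X -> R[i]) : Prop :=
  (forall y, D' y <-> {within D, continuous (fun x => A x y)}) /\
  (forall y, D' y -> dual_elem (B y) /\ forall x, D x -> (B y x)^* = A x y).

Definition selfadjoint (D : set X) (A : X -> X -> R[i]) : Prop :=
  is_adjoint D A D A.

Definition extends (D0 : set X) (A0 : X -> X -> R[i])
    (D : set X) (A : X -> X -> R[i]) : Prop :=
  D0 `<=` D /\ forall x, D0 x -> A x = A0 x.

End Defs.

(* Main.v *)
Require Import Defs.
From HB Require Import structures.
From mathcomp Require Import all_boot all_order all_algebra.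
From mathcomp Require Import all_classical all_reals all_analysis.
From mathcomp Require Import complex.
From mathcomp Require Import ring lra.
Import Order.TTheory GRing.Theory Num.Theory.
Import numFieldTopology.Exports numFieldNormedType.Exports.
Local Open Scope classical_set_scope.
Local Open Scope ring_scope.
Local Open Scope complex_scope.

(* Following Friedrichs, call (u, v) in X x X^* an element of the graph of A if u is a limit of
   x_n in D0 such that a x_n -> v in the dual norm of the form norm |y|_a = sqrt (a y, y).  The
   graph is linear, symmetric and inherits the lower bound by passing to the limit, and it is
   single-valued since D0 is dense.  It is onto X^*: given v, the minimizing sequences of
   (a x, x) - 2 Re (v, x) converge in X because gamma |x|^2 <= |x|_a^2, and they satisfy
   a x_n -> v, so that the completion of D0 in the form norm never has to be built.  A symmetric
   operator onto X^* is self-adjoint: if x |-> (A x, y) is bounded on D, extend it to w in X^*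
   and choose y' with A y' = w; then y - y' is annihilated by the range of A, that is by X^*,
   and vanishes by the Hahn-Banach theorem. *)

Local Notation Re := complex.Re.
Local Notation Im := complex.Im.

(** * Real Hahn-Banach theorem in sandwich form, obtained from minimal sublinear functionals *)

Section HahnBanach.
Context {R : realType} {V : lmodType R}.
Implicit Types (p q f : V -> R) (C : set V).

Definition sublinear p : Prop :=
  (forall x y, p (x + y) <= p x + p y) /\
  (forall (t : R) x, 0 <= t -> p (t *: x) = t * p x).

Definition convex_cone C : Prop :=
  [/\ C 0, forall x y, C x -> C y -> C (x + y) &
      forall (t : R) x, 0 <= t -> C x -> C (t *: x)].

Definition superlinear_on C f : Prop :=
  (forall x y, C x -> C y -> f x + f y <= f (x + y)) /\
  (forall (t : R) x, 0 <= t -> C x -> f (t *: x) = t * f x).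

Lemma sublinear0 p : sublinear p -> p 0 = 0.
Proof. by case=> _ pZ; rewrite -(scale0r 0) pZ ?mul0r. Qed.

Lemma sublinear_ge p x : sublinear p -> - p (- x) <= p x.
Proof.
by move=> psub; have := psub.1 x (- x); rewrite subrr sublinear0 //; lra.
Qed.

(* The infimal convolution q x = inf {p (x + c) - f c | c in C} works. *)
Lemma sublinear_reduction p C f : sublinear p -> convex_cone C ->
    superlinear_on C f -> (forall x, C x -> f x <= p x) ->
  exists q, [/\ sublinear q, forall x, q x <= p x &
    forall x c, C c -> q x <= p (x + c) - f c].
Proof.
move=> psub [C0 CD CZ] [fD fZ] fp; have [pD pZ] := psub.
pose E x := [set p (x + c) - f c | c in C].
(* Subadditivity together with [f c <= p c] gives a lower bound independent of [c], so the infimum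
   is finite. *)
have lbE x c : C c -> - p (- x) <= p (x + c) - f c.
  move=> Cc; have := pD (x + c) (- x); rewrite addrAC subrr add0r.
  by have := fp c Cc; lra.
have hinf x : has_inf (E x).
  split; first by exists (p (x + 0) - f 0), 0.
  by exists (- p (- x)) => _ [c Cc <-]; exact: lbE.
pose q x := inf (E x).
have qle x c : C c -> q x <= p (x + c) - f c.
  by move=> Cc; apply: (ge_inf (hinf x).2); exists c.
have qge x r : (forall c, C c -> r <= p (x + c) - f c) -> r <= q x.
  by move=> h; apply: lb_le_inf; [exact: (hinf x).1|move=> _ [c Cc <-]; exact: h].
have f0 : f 0 = 0 by rewrite -(scale0r 0) fZ ?mul0r.
have qp x : q x <= p x by have := qle x 0 C0; rewrite addr0 f0 subr0.
exists q; split => //.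
(* One inequality suffices: applied to [t^-1] and [t *: x], it gives the reverse one. *)
have qZ t x : 0 < t -> t * q x <= q (t *: x).
  move=> t0; apply: (qge) => c Cc; have ti : 0 <= t^-1 by rewrite invr_ge0 ltW.
  have := qle x (t^-1 *: c) (CZ _ _ ti Cc); rewrite -(ler_pM2l t0).
  rewrite fZ // mulrBr -(pZ t) ?(ltW t0) // scalerDr !scalerA mulrA divff ?gt_eqF //.
  by rewrite scale1r mul1r.
split=> [x y|t x].
  rewrite -lerBlDr; apply: (qge) => c Cc; rewrite lerBlDr -lerBlDl; apply: (qge) => d Cd.
  have := qle (x + y) (c + d) (CD _ _ Cc Cd); have := fD _ _ Cc Cd.
  by have := pD (x + c) (y + d); rewrite addrACA; lra.
rewrite le_eqVlt => /orP[/eqP<-|t0].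
  rewrite scale0r mul0r; apply/eqP; rewrite eq_le -{1}(sublinear0 _ psub) qp /=.
  by apply: (qge) => c Cc; rewrite add0r subr_ge0 fp.
apply/eqP; rewrite eq_le qZ // andbT.
have ti : 0 < t^-1 by rewrite invr_gt0.
have := qZ _ (t *: x) ti; rewrite scalerA mulVf ?gt_eqF // scale1r.
by rewrite -(ler_pM2l t0) mulrA divff ?gt_eqF // mul1r.
Qed.

(** Zorn's lemma: the pointwise infimum of a chain is again sublinear, and [- p (- x)] keeps it
    finite. *)
Lemma sublinear_minimal p : sublinear p ->
  exists q, [/\ sublinear q, forall x, q x <= p x &
    forall q', sublinear q' -> (forall x, q' x <= q x) -> q' = q].
Proof.
move=> psub.
pose T := {q : V -> R | sublinear q /\ forall x, q x <= p x}.
(* The order is reversed, so that a maximal element for Zorn's lemma is a minimal functional. *)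
pose ge (s t : T) := `[< forall x, sval t x <= sval s x >].
have [|s t u /asboolP st /asboolP tu|A Atot|[q [qsub qp]] qmin] :=
  @ZL_preorder T (exist _ p (conj psub (fun x => lexx (p x)))) ge.
- by move=> t; apply/asboolP.
- by apply/asboolP => x; exact: le_trans (tu x) (st x).
- have [->|/set0P[s0 As0]] := eqVneq A set0.
    by exists (exist _ p (conj psub (fun x => lexx (p x)))).
  pose E x := [set sval s x | s in A].
  have lbE x (s : T) : - p (- x) <= sval s x.
    by case: s => q [qsub qp] /=; have := sublinear_ge q x qsub; have := qp (- x); lra.
  have hinf x : has_inf (E x).
    split; first by exists (sval s0 x), s0.
    by exists (- p (- x)) => _ [s _ <-].
  pose q x := inf (E x).
  have qle x s : A s -> q x <= sval s x.
    by move=> As; apply: (ge_inf (hinf x).2); exists s.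
  have qge x r : (forall s, A s -> r <= sval s x) -> r <= q x.
    by move=> h; apply: lb_le_inf; [exact: (hinf x).1|move=> _ [s As <-]; exact: h].
  have qsub : sublinear q.
    split=> [x y|t x t0].
      rewrite -lerBlDr; apply: (qge) => s As; rewrite lerBlDr -lerBlDl; apply: (qge) => s' As'.
      (* Of the two members of the chain, the smaller one serves for both [x] and [y]. *)
      have [/asboolP le|/asboolP le] := Atot _ _ As As'.
        by have := qle (x + y) _ As'; have := (svalP s').1.1 x y; have := le x; lra.
      by have := qle (x + y) _ As; have := (svalP s).1.1 x y; have := le y; lra.
    have [->|tn0] := eqVneq t 0.
      rewrite scale0r mul0r; apply/eqP; rewrite eq_le.
      rewrite (le_trans (qle 0 _ As0)) ?(sublinear0 _ (svalP s0).1) //=.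
      by apply: (qge) => s As; rewrite (sublinear0 _ (svalP s).1).
    have tp : 0 < t by rewrite lt_def tn0.
    apply/eqP; rewrite eq_le; apply/andP; split.
      rewrite -ler_pdivrMl //; apply: (qge) => s As.
      by rewrite ler_pdivrMl // -((svalP s).1.2 _ _ t0); exact: qle.
    by apply: (qge) => s As; rewrite ((svalP s).1.2 _ _ t0) ler_wpM2l // qle.
  have qp x : q x <= p x by rewrite (le_trans (qle x _ As0)) // (svalP s0).2.
  by exists (exist _ q (conj qsub qp)) => s As; apply/asboolP => x; exact: qle.
- exists q; split=> // q' q'sub q'q; apply/funext => x; apply/eqP; rewrite eq_le q'q /=.
  pose t' : T := exist _ q' (conj q'sub (fun x => le_trans (q'q x) (qp x))).
  have qt' : ge (exist _ q (conj qsub qp)) t' by apply/asboolP.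
  by have /asboolP := qmin t' qt'; apply.
Qed.

(** A minimal sublinear functional below the reduction of [p] by [f] is linear. The reduction turns
    domination of [f] into an upper bound at [- x], which linearity converts into [f x <= g x]. *)
Theorem hahn_banach p C f : sublinear p -> convex_cone C ->
    superlinear_on C f -> (forall x, C x -> f x <= p x) ->
  exists g : V -> R, [/\ (forall (t : R) x y, g (t *: x + y) = t * g x + g y),
    forall x, g x <= p x & forall x, C x -> f x <= g x].
Proof.
move=> psub Ccone fsup fp.
have [p' [p'sub p'p p'f]] := sublinear_reduction _ _ _ psub Ccone fsup fp.
have [g [gsub gp' gmin]] := sublinear_minimal _ p'sub.
have [gD gZ] := gsub.
(* Reducing g along the ray of z, where g is itself superlinear, gives back g by minimality;
   this yields superadditivity. *)
have gsuper x z : g x + g z <= g (x + z).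
  pose C' := [set t *: z | t in [set t : R | 0 <= t]].
  have C'cone : convex_cone C'.
    split; first by exists 0 => //=; rewrite scale0r.
      by move=> _ _ [s s0 <-] [t t0 <-]; exists (s + t); rewrite ?scalerDl //=; exact: addr_ge0.
    by move=> t _ t0 [s s0 <-]; exists (t * s); rewrite ?scalerA //=; exact: mulr_ge0.
  have g'sup : superlinear_on C' g.
    split=> [_ _ [s s0 <-] [t t0 <-]|t y t0 _]; last exact: gZ.
    by rewrite -scalerDl !gZ ?mulrDl //; exact: addr_ge0.
  have [q [qsub qg qf]] := sublinear_reduction _ _ _ gsub C'cone g'sup (fun x _ => lexx _).
  have C'z : C' z by exists 1; rewrite ?scale1r //= ler01.
  by have := qf x z C'z; rewrite (gmin _ qsub qg); lra.
have gadd x y : g (x + y) = g x + g y by apply/eqP; rewrite eq_le gD gsuper.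
have gN x : g (- x) = - g x.
  by have := gadd x (- x); rewrite subrr (sublinear0 _ gsub); lra.
exists g; split => [t x y|x|x Cx].
- rewrite gadd; congr (_ + _); have [t0|/ltW t0] := leP 0 t; first exact: gZ.
  by rewrite -[t]opprK scaleNr gN gZ ?oppr_ge0 // !mulNr.
- exact: le_trans (gp' x) (p'p x).
- by have := p'f (- x) x Cx; have := gp' (- x); rewrite addNr (sublinear0 _ psub) gN; lra.
Qed.

End HahnBanach.

(** * Real-valued norms, and continuity expressed by real estimates *)

(** Norms over [R[i]] take values in [R[i]]; their real part makes real infima and real arithmetic
    available. *)
Definition rnorm {R : realType} {V : normedZmodType R[i]} (x : V) : R := Re `|x|.

Section RealNorm.
Context {R : realType}.

Lemma norm_rnorm {V : normedZmodType R[i]} (x : V) : `|x| = (rnorm x)%:C.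
Proof. by rewrite RRe_real // ger0_real. Qed.

Lemma rnorm_ge0 {V : normedZmodType R[i]} (x : V) : 0 <= rnorm x.
Proof. by rewrite -ler0c -norm_rnorm. Qed.

Lemma rnormD {V : normedZmodType R[i]} (x y : V) : rnorm (x + y) <= rnorm x + rnorm y.
Proof. by rewrite -lecR rmorphD /= -!norm_rnorm ler_normD. Qed.

Lemma rnormN {V : normedZmodType R[i]} (x : V) : rnorm (- x) = rnorm x.
Proof. by rewrite /rnorm normrN. Qed.

Lemma rnormB {V : normedZmodType R[i]} (x y : V) : rnorm (x - y) = rnorm (y - x).
Proof. by rewrite -rnormN opprB. Qed.

Lemma rnorm0 {V : normedZmodType R[i]} : rnorm (0 : V) = 0.
Proof. by rewrite /rnorm normr0. Qed.

Lemma rnorm0_eq0 {V : normedZmodType R[i]} (x : V) : rnorm x = 0 -> x = 0.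
Proof. by move=> x0; apply/normr0_eq0; rewrite norm_rnorm x0. Qed.

Lemma rnormZ {V : normedModType R[i]} (c : R[i]) (x : V) :
  rnorm (c *: x) = rnorm c * rnorm x.
Proof.
by apply: complexI; rewrite -norm_rnorm normrZ !norm_rnorm -rmorphM.
Qed.

Lemma rnormM (c d : R[i]) : rnorm (c * d) = rnorm c * rnorm d.
Proof. by apply: complexI; rewrite -norm_rnorm normrM !norm_rnorm -rmorphM. Qed.

Lemma rnorm_real (r : R) : rnorm r%:C = `|r|.
Proof. by rewrite /rnorm normc_def /= expr0n addr0 sqrtr_sqr. Qed.

Lemma rnormJ (c : R[i]) : rnorm c^* = rnorm c.
Proof. by rewrite /rnorm normcJ. Qed.

Lemma Re_le_rnorm (c : R[i]) : `|Re c| <= rnorm c.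
Proof. by rewrite -lecR -norm_rnorm normc_ge_Re. Qed.

Lemma rnorm_sqr (c : R[i]) : rnorm c ^+ 2 = Re c ^+ 2 + Im c ^+ 2.
Proof. by apply: complexI; rewrite add_Re2_Im2 norm_rnorm rmorphXn. Qed.

Lemma rnorm_le_ReIm (c : R[i]) : rnorm c <= `|Re c| + `|Im c|.
Proof.
rewrite -(ler_pXn2r (ltn0Sn 1)) ?nnegrE ?addr_ge0 ?rnorm_ge0 //.
rewrite rnorm_sqr -(real_normK (num_real (Re c))) -(real_normK (num_real (Im c))).
by have := normr_ge0 (Re c); have := normr_ge0 (Im c); nra.
Qed.

Lemma lt0c_real (e : R[i]) : 0 < e -> exists2 r : R, 0 < r & e = r%:C.
Proof.
move=> e0; exists (Re e); last by rewrite RRe_real // gtr0_real.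
by move: e0; rewrite ltcE => /andP[].
Qed.

Section Topology.
Context {X : completeNormedModType R[i]}.

Lemma dense_rnorm (D : set X) x (e : R) : dense D -> 0 < e ->
  exists2 y, D y & rnorm (x - y) < e.
Proof.
move=> dD e0; have ec : 0 < e%:C :> R[i] by rewrite ltcR.
have [||y [By Dy]] := dD (ball x e%:C).
- by exists x; exact: ballxx.
- exact: ball_open.
- by exists y => //; rewrite -ltcR -norm_rnorm; move: By; rewrite -ball_normE.
Qed.

Lemma cauchy_rnorm (u : nat -> X) :
    (forall e : R, 0 < e -> exists n0, forall m n, (n0 <= m)%N -> (n0 <= n)%N ->
       rnorm (u m - u n) <= e) ->
  exists l, forall e : R, 0 < e -> exists n0, forall n, (n0 <= n)%N ->
    rnorm (u n - l) <= e.
Proof.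
move=> ucauchy.
have /cauchy_cvgP/cvg_ex[l ul] : cauchy (u @ \oo).
  apply/cauchy_ballP => _ /lt0c_real[e e0 ->].
  have [n0 hn0] := ucauchy (e / 2) ltac:(lra).
  exists ([set x | exists2 n, (n0 <= n)%N & u n = x],
          [set x | exists2 n, (n0 <= n)%N & u n = x]).
    by split; exists n0 => //= n n0n; exists n.
  move=> [_ _] /= [[m hm <-] [n hn <-]]; rewrite -ball_normE /= norm_rnorm ltcR.
  by have := hn0 m n hm hn; lra.
exists l => e e0.
have /cvgrPdist_le/(_ e%:C) := ul.
rewrite ltcR => /(_ e0)[n0 _ hn0]; exists n0 => n /hn0 /=.
by rewrite norm_rnorm lecR rnormB.
Qed.

(** Continuity at 0 bounds [f] on a small ball, and scaling spreads the bound. Homogeneity is asked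
    for real scalars only, so that linear and conjugate-linear maps are both covered. *)
Lemma within_continuous_bound (D : set X) (f : X -> R[i]) : D 0 ->
    (forall (r : R) x, D x -> D (r%:C *: x)) ->
    (forall (r : R) x, D x -> f (r%:C *: x) = r%:C * f x) ->
    {within D, continuous f} ->
  exists2 M : R, 0 <= M & forall x, D x -> rnorm (f x) <= M * rnorm x.
Proof.
move=> D0 DZ fZ /subspace_continuousP/(_ 0 D0)/cvg_ballP/(_ 1 ltr01).
have f0 : f 0 = 0 by have := fZ 0 0 D0; rewrite scaler0 mul0r.
rewrite near_withinE => /nbhs_ballP[_ /lt0c_real[d d0 ->] hd].
have {}hd x : rnorm x < d -> D x -> rnorm (f x) < 1.
  move=> xd Dx; have : ball (f 0) 1 (f x).
    by apply: hd => //; rewrite -ball_normE /= sub0r normrN norm_rnorm ltcR.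
  by rewrite f0 /ball /= sub0r normrN norm_rnorm -[1]/((1 : R)%:C) ltcR.
have d2 : 0 < d / 2 by lra.
(* A nonzero [x] is rescaled to norm [d / 2], strictly inside the ball where [f] stays below 1. *)
exists (2 / d) => [|x Dx]; first by rewrite divr_ge0 // ltW.
have [x0|xn0] := eqVneq (rnorm x) 0.
  by rewrite (rnorm0_eq0 _ x0) f0 !rnorm0 mulr0.
have xp : 0 < rnorm x by rewrite lt_def xn0 rnorm_ge0.
pose r := d / 2 / rnorm x; have rp : 0 < r by rewrite divr_gt0.
have : rnorm (f (r%:C *: x)) < 1.
  apply: hd (DZ _ _ Dx); rewrite rnormZ rnorm_real gtr0_norm //.
  by rewrite /r divfK //; lra.
rewrite fZ // rnormM rnorm_real gtr0_norm // => /ltW.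
rewrite -ler_pdivlMl // => /le_trans; apply.
by rewrite /r mulr1 !invfM !invrK (mulrC d^-1).
Qed.

Lemma bound_within_continuous (D : set X) (f : X -> R[i]) (M : R) :
    (forall x y, D x -> D y -> rnorm (f x - f y) <= M * rnorm (x - y)) ->
  {within D, continuous f}.
Proof.
move=> fM; apply/subspace_continuousP => x Dx.
apply/cvg_ballP => _ /lt0c_real[e e0 ->].
rewrite near_withinE; apply/nbhs_ballP.
have M1 : 0 < `|M| + 1 by rewrite ltr_wpDl.
exists (e / (`|M| + 1))%:C => /=; first by rewrite ltcR divr_gt0.
move=> y; rewrite -ball_normE /= norm_rnorm ltcR ltr_pdivlMr // => xy Dy.
rewrite /ball /= norm_rnorm ltcR.
have := fM x y Dx Dy; have := rnorm_ge0 (x - y); have := ler_norm M; nra.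
Qed.

End Topology.
End RealNorm.

(* V with scalars restricted to R; hahn_banach is stated for real vector spaces. *)
Definition realification {R : rcfType} (V : lmodType R[i]) : Type := V.

Section Realification.
Context {R : rcfType} {V : lmodType R[i]}.

HB.instance Definition _ := GRing.Zmodule.on (realification V).

Let scale (t : R) (x : realification V) : realification V := t%:C *: (x : V).

Let scaleA s t x : scale s (scale t x) = scale (s * t) x.
Proof. by rewrite /scale scalerA -rmorphM. Qed.

Let scale1 : left_id 1 scale.
Proof. by move=> x; rewrite /scale scale1r. Qed.

Let scaleDr : right_distributive scale +%R.
Proof. by move=> t x y; rewrite /scale scalerDr. Qed.

Let scaleDl x : {morph scale^~ x : s t / s + t}.
Proof. by move=> s t; rewrite /scale rmorphD scalerDl. Qed.

HB.instance Definition _ := GRing.Zmodule_isLmodule.Build R (realification V)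
  scaleA scale1 scaleDr scaleDl.

Lemma realificationZ (t : R) (x : realification V) : t *: x = t%:C *: (x : V).
Proof. by []. Qed.

End Realification.

(** * The conjugate dual: bounded functionals, extension and separation *)

Section DualElements.
Context {R : realType} {X : completeNormedModType R[i]}.
Implicit Types (v : X -> R[i]) (x y z : X).

Lemma conjlin0 v : conjlin v -> v 0 = 0.
Proof.
move=> vlin; have := vlin 1 0 0; rewrite scale1r add0r (rmorph1 (@conjc R)) mul1r.
by rewrite -[LHS]addr0 => /addrI.
Qed.

Lemma conjlinZ v (c : R[i]) x : conjlin v -> v (c *: x) = c^* * v x.
Proof. by move=> vlin; rewrite -[_ *: _]addr0 vlin conjlin0 // addr0. Qed.

Lemma conjlinB v x y : conjlin v -> v (x - y) = v x - v y.
Proof.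
by move=> vl; rewrite addrC -scaleN1r vl rmorphN rmorph1 mulN1r addrC.
Qed.

Lemma dual_elemP v : dual_elem v <->
  conjlin v /\ exists2 M : R, 0 <= M & forall x, rnorm (v x) <= M * rnorm x.
Proof.
split=> [[vlin vcont]|[vlin [M M0 vM]]]; split=> //.
  have [||||M M0 vM] := @within_continuous_bound R X setT v.
  - by [].
  - by [].
  - by move=> r x _; rewrite conjlinZ //; congr (_ * _); exact: conjc_real.
  - exact: continuous_subspaceT.
  - by exists M => // x; exact: vM.
apply/continuous_subspace_setT/(@bound_within_continuous R X setT v M) => x y _ _.
by rewrite -conjlinB.
Qed.

(** A conjugate-linear [v] satisfies [v ('i *: x) = - 'i * v x], so its imaginary part at [x] is its
    real part at ['i *: x]. This dictates the formula, including the plus sign. *)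
Lemma complexify_dual (g : X -> R) (M : R) : 0 <= M ->
    (forall (t : R) x y, g (t%:C *: x + y) = t * g x + g y) ->
    (forall x, g x <= M * rnorm x) ->
  dual_elem (fun x => g x +i* g ('i *: x)).
Proof.
move=> M0 glin gM; apply/dual_elemP; split=> [[a b] x y|].
  have gE c d z u : g ((c +i* d) *: z + u) = c * g z + d * g ('i *: z) + g u.
    have -> : (c +i* d) *: z + u = c%:C *: z + (d%:C *: ('i *: z) + u).
      rewrite addrA scalerA -scalerDl; congr (_ *: _ + _).
      by apply/eqP; rewrite eq_complex /= !(mul0r, mulr0, mulr1, subr0, addr0, add0r) !eqxx.
    by rewrite !glin addrA.
  rewrite scalerDr gE.
  have -> : 'i *: ((a +i* b) *: x) = ((- b) +i* a) *: x.
    rewrite scalerA; congr (_ *: _).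
    by apply/eqP; rewrite eq_complex /= !(mul0r, mul1r, subr0, sub0r, addr0, add0r) !eqxx.
  rewrite gE; apply/eqP; rewrite eq_complex /=.
  by apply/andP; split; apply/eqP; ring.
have gN x : g (- x) = - g x.
  have g0 : g 0 = 0 by have := glin 1 0 0; rewrite scaler0 addr0; lra.
  by have := glin (-1) x 0; rewrite addr0 rmorphN rmorph1 scaleN1r g0; lra.
have gabs x : `|g x| <= M * rnorm x.
  by rewrite ler_norml gM andbT lerNl -gN -rnormN.
(* Only continuity is at stake, so the crude bound by the sum of both coordinates is enough. *)
exists (M + M) => [|x]; first exact: addr_ge0.
apply: le_trans (rnorm_le_ReIm _) _ => /=.
have := gabs x; have := gabs ('i *: x); rewrite rnormZ.
have -> : rnorm ('i : R[i]) = 1.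
  by rewrite /rnorm normc_def /= expr0n expr1n add0r sqrtr1.
lra.
Qed.

Lemma sublinear_rnorm (M : R) : 0 <= M ->
  sublinear (fun x : realification X => M * rnorm (x : X)).
Proof.
move=> M0; split=> [x y|t x t0]; first by rewrite -mulrDr ler_wpM2l ?rnormD.
by rewrite realificationZ rnormZ rnorm_real ger0_norm // mulrCA.
Qed.

(** With the norm as both bounds on the ray through [x], Hahn-Banach yields a functional whose real
    part at [x] is at least [rnorm x]. *)
Lemma dual_separates x : (forall v, dual_elem v -> v x = 0) -> x = 0.
Proof.
move=> x0.
pose C := [set t *: (x : realification X) | t in [set t : R | 0 <= t]].
have Ccone : convex_cone C.
  split; first by exists 0 => //=; rewrite scale0r.
    by move=> _ _ [s s0 <-] [t t0 <-]; exists (s + t); rewrite ?scalerDl //=; exact: addr_ge0.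
  by move=> t _ t0 [s s0 <-]; exists (t * s); rewrite ?scalerA //=; exact: mulr_ge0.
have psub := sublinear_rnorm 1 ler01.
have Csup : superlinear_on C (fun y => 1 * rnorm (y : X)).
  split=> [_ _ [s s0 <-] [t t0 <-]|t y t0 _]; last exact: psub.2.
  by rewrite -scalerDl !psub.2 ?mulrDl //; exact: addr_ge0.
have [g [glin gp gC]] := hahn_banach _ _ _ psub Ccone Csup (fun y _ => lexx _).
have := x0 _ (complexify_dual g 1 ler01 glin gp) => -[gx0 _].
have := gC x; rewrite gx0 mul1r => h; apply: rnorm0_eq0.
apply/eqP; rewrite eq_le rnorm_ge0 h //.
by exists 1; rewrite ?scale1r //= ler01.
Qed.

(** Only the real part of [w] is extended by Hahn-Banach; complexification then recovers the
    imaginary part. *)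
Lemma dual_extension (D : set X) (w : X -> R[i]) (M : R) : linear_subspace D ->
    (forall c x y, D x -> D y -> w (c *: x + y) = c^* * w x + w y) ->
    0 <= M -> (forall x, D x -> rnorm (w x) <= M * rnorm x) ->
  exists2 v, dual_elem v & forall x, D x -> v x = w x.
Proof.
move=> [D0 Dlin] wlin M0 wM.
have DZ c x : D x -> D (c *: x) by move=> Dx; rewrite -[_ *: _]addr0; exact: Dlin.
have w0 : w 0 = 0.
  have := wlin 1 0 0 D0 D0; rewrite scale1r add0r (rmorph1 (@conjc R)) mul1r.
  by rewrite -[LHS]addr0 => /addrI.
have wZ c x : D x -> w (c *: x) = c^* * w x.
  by move=> Dx; rewrite -[_ *: _]addr0 wlin // w0 addr0.
have Dcone : convex_cone (D : set (realification X)).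
  split=> // [x y Dx Dy|t x _]; last exact: DZ.
  by rewrite -[x]scale1r; exact: Dlin.
have wsup : superlinear_on (D : set (realification X)) (fun x => Re (w x)).
  split=> [x y Dx Dy|t x t0 Dx].
    by rewrite -raddfD -[x in x + y]scale1r wlin // (rmorph1 (@conjc R)) mul1r.
  by rewrite wZ //=; case: (w x) => a b /=; rewrite oppr0 mul0r subr0.
have wp (x : realification X) : D x -> Re (w x) <= M * rnorm (x : X).
  by move=> /wM; apply: le_trans; apply: le_trans (Re_le_rnorm _); exact: ler_norm.
have [g [glin gp gD]] := hahn_banach _ _ _ (sublinear_rnorm M M0) Dcone wsup wp.
exists (fun x => g x +i* g ('i *: x)); first exact: complexify_dual glin gp.
(* The sandwich gives one inequality on [D]; the other comes from applying it to [- x], which also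
   lies in [D]. *)
have gE x : D x -> g x = Re (w x).
  move=> Dx; apply/eqP; rewrite eq_le gD // andbT.
  have := gD (- x); rewrite -[- x]scaleN1r => /(_ (DZ _ _ Dx)).
  have -> : g (-1 *: x : X) = - g x.
    have g0 : g 0 = 0 by have := glin 1 0 0; rewrite scaler0 addr0; lra.
    by have := glin (-1) x 0; rewrite addr0 realificationZ rmorphN rmorph1 g0; lra.
  rewrite wZ // rmorphN (rmorph1 (@conjc R)) mulN1r raddfN /=; lra.
move=> x Dx; rewrite !gE //; last exact: DZ.
rewrite wZ //; case: (w x) => a b /=; congr (_ +i* _); ring.
Qed.

Lemma dual_elem_lin v w (c : R[i]) : dual_elem v -> dual_elem w ->
  dual_elem (fun x => c * v x + w x).
Proof.
move=> /dual_elemP[vl [M M0 vM]] /dual_elemP[wl [N N0 wN]].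
apply/dual_elemP; split=> [d x y|]; first by rewrite vl wl; ring.
exists (rnorm c * M + N) => [|x]; first by rewrite addr_ge0 ?mulr_ge0 ?rnorm_ge0.
apply: le_trans (rnormD _ _) _; rewrite rnormM mulrDl lerD // -mulrA.
by rewrite ler_wpM2l ?rnorm_ge0.
Qed.

Lemma dual_eq0_dense (D : set X) v : dense D -> dual_elem v ->
  (forall x, D x -> v x = 0) -> forall x, v x = 0.
Proof.
move=> dD /dual_elemP[vl [M M0 vM]] vD x; apply: rnorm0_eq0.
apply/eqP; rewrite eq_le rnorm_ge0 andbT; apply/ler_addgt0Pr => e e0.
rewrite add0r; have M1 : 0 < M + 1 by lra.
have [y Dy xy] := dense_rnorm D x (e / (M + 1)) dD (divr_gt0 e0 M1).
have vxy : v (x - y) = v x by rewrite conjlinB // (vD y Dy); exact: subr0.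
have := vM (x - y); rewrite vxy.
by move: xy; rewrite ltr_pdivlMr //; have := rnorm_ge0 (x - y); nra.
Qed.

End DualElements.

(** * Coordinates of complex numbers *)

Section ReIm.
Context {R : realType}.
Implicit Types (c d : R[i]).

Lemma ReD c d : Re (c + d) = Re c + Re d. Proof. by case: c d => ? ? []. Qed.
Lemma ImD c d : Im (c + d) = Im c + Im d. Proof. by case: c d => ? ? []. Qed.
Lemma ReN c : Re (- c) = - Re c. Proof. by case: c. Qed.
Lemma ImN c : Im (- c) = - Im c. Proof. by case: c. Qed.
Lemma ReM c d : Re (c * d) = Re c * Re d - Im c * Im d.
Proof. by case: c d => ? ? []. Qed.
Lemma ImM c d : Im (c * d) = Re c * Im d + Im c * Re d.
Proof. by case: c d => ? ? []. Qed.
Lemma ReJ c : Re c^* = Re c. Proof. by case: c. Qed.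
Lemma ImJ c : Im c^* = - Im c. Proof. by case: c. Qed.
Definition ReImE := (ReD, ImD, ReN, ImN, ReM, ImM, ReJ, ImJ).

Lemma complex_eq c d : Re c = Re d -> Im c = Im d -> c = d.
Proof. by case: c d => ? ? [? ?] /= -> ->. Qed.

End ReIm.

(** * The form of [a], and the graph of its extension *)

Definition quad {R : realType} {X : Type} (a : X -> X -> R[i]) x : R := Re (a x x).

Definition form_norm {R : realType} {X : Type} (a : X -> X -> R[i]) x : R :=
  Num.sqrt (quad a x).

(** Replaces passage to the limit: an estimate up to a multiple of [e] is enough. *)
Lemma le0_of_small {R : realFieldType} (t K : R) :
  (forall e, 0 < e -> e <= 1 -> t <= K * e) -> t <= 0.
Proof.
move=> h; rewrite leNgt; apply/negP => t0.
have tK : t <= K by rewrite -[K]mulr1 h.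
have K0 : 0 < K by lra.
(* This [e] is at most 1 because [t <= K], and it turns the hypothesis into [t <= t / 2]. *)
have := h (t / (2 * K)) _ _.
have -> : K * (t / (2 * K)) = t / 2 by field; rewrite gt_eqF.
move=> h'; suff : t <= t / 2 by lra.
apply: h'; first by rewrite divr_gt0 // mulr_gt0.
by rewrite ler_pdivrMr ?mulr_gt0 //; lra.
Qed.

Section Form.
Context {R : realType} {X : completeNormedModType R[i]}.
Context {D0 : set X} {a : X -> X -> R[i]}.
Hypothesis ha : dd_operator D0 a.
Context {gamma : R}.
Hypotheses (hgamma : 0 < gamma) (hlb : lower_bound gamma D0 a).

Local Notation q := (quad a).
Local Notation s := (form_norm a).

Lemma dom0 : D0 0. Proof. by case: ha => -[]. Qed.

Lemma dom_lin c x y : D0 x -> D0 y -> D0 (c *: x + y).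
Proof. by case: ha => -[_ h] _ _ _; exact: h. Qed.

Lemma dom_sub x y : D0 x -> D0 y -> D0 (x - y).
Proof. by move=> Dx Dy; rewrite addrC -scaleN1r; exact: dom_lin. Qed.

Lemma form_linl c x y z : D0 x -> D0 y -> a (c *: x + y) z = c * a x z + a y z.
Proof. by case: ha => _ _ h _ Dx Dy; rewrite h. Qed.

Lemma form_dual x : D0 x -> dual_elem (a x).
Proof. by case: ha => _ _ _; apply. Qed.

Lemma form_linr c x y z : D0 x -> a x (c *: y + z) = c^* * a x y + a x z.
Proof. by move=> Dx; rewrite (form_dual _ Dx).1. Qed.

(** The order of [R[i]] compares only numbers with equal imaginary parts, so the lower bound also
    says that the form is real on the diagonal. *)
Lemma form_real x : D0 x -> Im (a x x) = 0 /\ gamma * rnorm x ^+ 2 <= q x.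
Proof.
move=> /hlb; rewrite norm_rnorm -rmorphXn -rmorphM lecE => /andP[/eqP -> /=].
by [].
Qed.

Lemma quad_ge0 x : D0 x -> 0 <= q x.
Proof.
by move=> /form_real[_]; apply: le_trans; rewrite mulr_ge0 ?sqr_ge0 ?ltW.
Qed.

Lemma seminorm_sqr x : D0 x -> s x ^+ 2 = q x.
Proof. by move=> Dx; rewrite sqr_sqrtr ?quad_ge0. Qed.

(** Polarization: the form is real at [c *: x + y], and the choices [c = 1] and [c = 'i] yield the
    two coordinates of the identity. *)
Lemma form_sym x y : D0 x -> D0 y -> a x y = (a y x)^*.
Proof.
move=> Dx Dy.
have E c : Im (c * a x y + c^* * a y x) = 0.
  have := (form_real _ (dom_lin c _ _ Dx Dy)).1.
  rewrite form_linl // !form_linr // !ReImE.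
  by rewrite (form_real _ Dx).1 (form_real _ Dy).1; lra.
have := E 1; have := E 'i; rewrite !ReImE /= => E1 E2.
by apply: complex_eq; rewrite !ReImE; lra.
Qed.

Lemma quad_lin c x y : D0 x -> D0 y ->
  q (c *: y + x) = rnorm c ^+ 2 * q y + q x + 2 * Re (c^* * a x y).
Proof.
move=> Dx Dy; rewrite /quad form_linl // !form_linr // (form_sym _ _ Dy Dx).
by rewrite rnorm_sqr !ReImE (form_real _ Dy).1; ring.
Qed.

(** A quantitative Euler equation: [a x - v] is half the derivative at [x] of the functional being
    minimized, and near-minimality makes it small in the dual of the form norm. *)
Lemma almost_minimizer v m delta x y : dual_elem v -> 0 <= delta ->
    (forall z, D0 z -> m <= q z - 2 * Re (v z)) -> D0 x -> D0 y ->
    q x - 2 * Re (v x) <= m + delta ->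
  rnorm (a x y - v y) <= Num.sqrt delta * s y.
Proof.
move=> [vl _] d0 hm Dx Dy hx; set w := a x y - v y.
have sw : 0 <= Num.sqrt delta * s y by rewrite mulr_ge0 ?sqrtr_ge0.
rewrite -(ler_pXn2r (ltn0Sn 1)) ?nnegrE ?rnorm_ge0 // exprMn sqr_sqrtr // seminorm_sqr //.
set W := rnorm w ^+ 2; have W0 : 0 <= W by exact: sqr_ge0.
(* Minimality tested at x - r w y. *)
have H r : 2 * r * W - r ^+ 2 * W * q y <= delta.
  have := hm _ (dom_lin (- (r%:C * w)) _ _ Dy Dx).
  rewrite quad_lin // rnormN rnormM rnorm_real exprMn real_normK ?num_real //.
  rewrite vl -/W; move: hx; rewrite !ReImE /=.
  have -> : Re (a x y) = Re w + Re (v y) by rewrite !ReImE; lra.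
  have -> : Im (a x y) = Im w + Im (v y) by rewrite !ReImE; lra.
  by have := rnorm_sqr w; rewrite -/W; nra.
(* If [q y] vanishes, [H] is linear in [r] and forces [W = 0]; otherwise [r = (q y)^-1] maximizes
   its left side. *)
have [Q0|Qn0] := eqVneq (q y) 0.
  have [->|Wn0] := eqVneq W 0; first by rewrite Q0 mulr0.
  have := H ((delta + 1) / (2 * W)).
  have -> : 2 * ((delta + 1) / (2 * W)) * W = delta + 1 by field.
  by rewrite Q0; lra.
have Qp : 0 < q y by rewrite lt_def Qn0 quad_ge0.
have := H (q y)^-1; rewrite expr2 => h; rewrite -ler_pdivrMr //.
apply: le_trans h; rewrite le_eqVlt; apply/orP; left; apply/eqP; field.
exact: Qn0.
Qed.

(** Sequences are replaced by one approximant for each [e]; the condition over [y] bounds the dual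
    form norm of [a x - v] by [e]. *)
Definition graph (u : X) (v : X -> R[i]) : Prop :=
  dual_elem v /\ forall e : R, 0 < e -> exists x, [/\ D0 x, rnorm (x - u) <= e &
    forall y, D0 y -> rnorm (a x y - v y) <= e * s y].

Lemma graph_form x : D0 x -> graph x (a x).
Proof.
move=> Dx; split=> [|e e0]; first exact: form_dual.
exists x; split=> [//||y Dy]; first by rewrite subrr rnorm0 ltW.
have -> : a x y - a x y = 0 by exact: subrr.
by rewrite rnorm0 mulr_ge0 ?sqrtr_ge0 ?ltW.
Qed.

Lemma graph_lin c u v u' v' : graph u v -> graph u' v' ->
  graph (c *: u + u') (fun x => c * v x + v' x).
Proof.
move=> [vd hv] [v'd hv']; split=> [|e e0]; first exact: dual_elem_lin.
have c1 : 0 < rnorm c + 1 by rewrite ltr_wpDl ?rnorm_ge0.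
(* Chosen so that the errors [rnorm c * d] and [d] add up to [e]. *)
pose d := e / (rnorm c + 1); have d0 : 0 < d by rewrite divr_gt0.
have dE : rnorm c * d + d = e by rewrite /d; field; rewrite gt_eqF.
have [x [Dx xu hx]] := hv d d0; have [x' [Dx' xu' hx']] := hv' d d0.
exists (c *: x + x'); split; first exact: dom_lin.
  rewrite opprD addrACA -scalerBr (le_trans (rnormD _ _)) // rnormZ.
  by rewrite -dE lerD // ler_wpM2l ?rnorm_ge0.
move=> y Dy; rewrite form_linl //.
have -> : c * a x y + a x' y - (c * v y + v' y)
    = c * (a x y - v y) + (a x' y - v' y) by ring.
rewrite (le_trans (rnormD _ _)) // rnormM -dE mulrDl lerD // ?hx' // -mulrA.
by rewrite ler_wpM2l ?rnorm_ge0 ?hx.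
Qed.

(** Approximants can be kept bounded in the form norm, uniformly in [e]: splitting [a x x] into
    [a x x - v x] and [v x] gives [s x ^+ 2 <= L + s x] with [L = M * (rnorm u + 1)], hence
    [s x <= L + 1]. *)
Lemma graph_approx u v : graph u v -> exists2 K : R, 0 <= K &
  forall e : R, 0 < e -> e <= 1 -> exists x, [/\ D0 x, rnorm (x - u) <= e, s x <= K &
    forall y, D0 y -> rnorm (a x y - v y) <= e * s y].
Proof.
move=> [/dual_elemP[vl [M M0 vM]] hv].
have L0 : 0 <= M * (rnorm u + 1) by rewrite mulr_ge0 ?addr_ge0 ?rnorm_ge0.
exists (M * (rnorm u + 1) + 1) => [|e e0 e1]; first by rewrite addr_ge0.
have [x [Dx xu hx]] := hv e e0; exists x; split => //.
have xle : rnorm x <= rnorm u + 1.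
  by have := rnormD (x - u) u; rewrite subrK; lra.
have s0 : 0 <= s x by exact: sqrtr_ge0.
have s2 := seminorm_sqr _ Dx.
have := Re_le_rnorm (a x x - v x); have := Re_le_rnorm (v x).
have := ler_norm (Re (v x)); have := ler_norm (Re (a x x - v x)).
rewrite !ReImE -/(q x) -s2.
have := vM x; have := hx x Dx.
have : e * s x <= s x by rewrite -[leRHS]mul1r ler_wpM2r.
have : M * rnorm x <= M * (rnorm u + 1) by rewrite ler_wpM2l.
move: (M * (rnorm u + 1)) L0 => L L0 *.
have h : s x ^+ 2 <= L + s x by lra.
by rewrite leNgt; apply/negP; nra.
Qed.

Lemma graph_sym u v u' v' : graph u v -> graph u' v' -> v u' = (v' u)^*.
Proof.
move=> G G'; have [K K0 hK] := graph_approx _ _ G.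
have [K' K'0 hK'] := graph_approx _ _ G'.
have [/dual_elemP[vl [M M0 vM]] _] := G.
have [/dual_elemP[v'l [M' M'0 v'M]] _] := G'.
suff : rnorm (v u' - (v' u)^*) <= 0.
  move=> h; apply/subr0_eq/rnorm0_eq0.
  by apply/eqP; rewrite eq_le rnorm_ge0 h.
apply: (@le0_of_small _ _ (M + K' + K + M')) => e e0 e1.
have [x [Dx xu sx hx]] := hK e e0 e1; have [x' [Dx' xu' sx' hx']] := hK' e e0 e1.
(* The values of the form at the approximants cancel by symmetry. The four remaining terms are at
   most [M], [K'], [K] and [M'] times [e]. *)
have -> : v u' - (v' u)^* = - v (x' - u') - (a x x' - v x') +
    (a x' x - v' x)^* + (v' (x - u))^*.
  rewrite !conjlinB // (form_sym _ _ Dx Dx').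
  by apply: complex_eq; rewrite !ReImE; ring.
rewrite !mulrDl (le_trans (rnormD _ _)) // lerD //; last first.
  by rewrite rnormJ (le_trans (v'M _)) // ler_wpM2l.
rewrite (le_trans (rnormD _ _)) // lerD //; last first.
  by rewrite rnormJ (le_trans (hx' _ Dx)) // mulrC ler_wpM2r // ltW.
rewrite (le_trans (rnormD _ _)) // lerD // rnormN.
  by rewrite (le_trans (vM _)) // ler_wpM2l.
by rewrite (le_trans (hx _ Dx')) // mulrC ler_wpM2r // ltW.
Qed.

Lemma graph_lower u v : graph u v -> gamma%:C * `|u| ^+ 2 <= v u.
Proof.
move=> G; have vu := graph_sym _ _ _ _ G G.
have Im0 : Im (v u) = 0.
  by have := congr1 (@complex.Im R) vu; rewrite !ReImE; lra.
rewrite norm_rnorm -rmorphXn -rmorphM lecE Im0 eqxx /=.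
have [K K0 hK] := graph_approx _ _ G.
have [/dual_elemP[vl [M M0 vM]] _] := G.
rewrite -subr_le0; apply: (@le0_of_small _ _ (K + M + 2 * gamma * rnorm u)) => e e0 e1.
have [x [Dx xu sx hx]] := hK e e0 e1.
have := (form_real _ Dx).2; have := ler_norm (Re (a x x - v x)).
have := ler_norm (Re (v (x - u))); have := Re_le_rnorm (v (x - u)).
have := Re_le_rnorm (a x x - v x); have := hx x Dx; have := vM (x - u).
rewrite conjlinB // !ReImE -/(q x).
have : e * s x <= K * e by rewrite mulrC ler_wpM2r // ltW.
have : M * rnorm (x - u) <= M * e by rewrite ler_wpM2l.
(* Expanding [(rnorm x - rnorm u) ^+ 2 >= 0] and using [rnorm x >= rnorm u - e] avoids squaring a
   difference of unknown sign. *)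
have : gamma * (rnorm u ^+ 2 - 2 * rnorm u * e) <= gamma * rnorm x ^+ 2.
  have ux : 0 <= e - (rnorm u - rnorm x).
    by have := rnormD (u - x) x; rewrite subrK (rnormB u); lra.
  apply: ler_wpM2l; first exact: ltW.
  by have := mulr_ge0 (rnorm_ge0 u) ux; have := sqr_ge0 (rnorm x - rnorm u); nra.
lra.
Qed.

(** The difference lies over 0; symmetry against [(x, a x)] makes it vanish on [D0], which is
    dense. *)
Lemma graph_functional u v v' : graph u v -> graph u v' -> v = v'.
Proof.
move=> G G'; have := graph_lin (-1) _ _ _ _ G' G.
rewrite scaleN1r addNr => G0; apply/funext => x.
apply/eqP; rewrite -subr_eq0; apply/eqP; rewrite addrC -mulN1r; move: x.
have dD : dense D0 by case: ha.
apply: dual_eq0_dense dD G0.1 _ => x Dx.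
rewrite (graph_sym _ _ _ _ G0 (graph_form _ Dx)) (conjlin0 _ (form_dual _ Dx).1).
by apply: complex_eq; rewrite /= ?oppr0.
Qed.

Lemma graph_surjective v : dual_elem v -> exists u, graph u v.
Proof.
move=> vd; have [vl [M M0 vM]] := (dual_elemP v).1 vd.
pose E := [set q z - 2 * Re (v z) | z in D0].
have hinf : has_inf E.
  split; first by exists (q 0 - 2 * Re (v 0)), 0 => //; exact: dom0.
  (* The minimum over real [t] of [gamma * t ^+ 2 - 2 * M * t], found by completing the square. *)
  exists (- (M ^+ 2 / gamma)) => _ [z Dz <-].
  have := (form_real _ Dz).2; have := vM z; have := Re_le_rnorm (v z).
  have := ler_norm (Re (v z)).
  have : 0 <= (gamma * rnorm z - M) ^+ 2 / gamma by rewrite divr_ge0 ?sqr_ge0 ?ltW.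
  have -> : (gamma * rnorm z - M) ^+ 2 / gamma =
    gamma * rnorm z ^+ 2 - 2 * (M * rnorm z) + M ^+ 2 / gamma.
    by field; rewrite gt_eqF.
  lra.
have hm z : D0 z -> inf E <= q z - 2 * Re (v z).
  by move=> Dz; apply: (ge_inf hinf.2); exists z.
have eps0 n : 0 < n.+1%:R^-1 :> R by rewrite invr_gt0 ltr0n.
have /choice[u hu] (n : nat) : exists x, D0 x /\
    forall y, D0 y -> rnorm (a x y - v y) <= n.+1%:R^-1 * s y.
  (* The tolerance is squared because [almost_minimizer] returns its square root. *)
  have d0 : 0 < n.+1%:R^-1 ^+ 2 :> R by rewrite exprn_gt0.
  have [_ [x Dx <-] /ltW hx] := inf_adherent d0 hinf.
  exists x; split=> // y Dy.
  have := almost_minimizer v _ _ _ _ vd (ltW d0) hm Dx Dy hx.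
  by rewrite sqrtr_sqr ger0_norm // ltW.
have small (e : R) : 0 < e -> exists n0 : nat, forall n, (n0 <= n)%N -> n.+1%:R^-1 <= e.
  move=> e0; have [n0 _ hn0] := near_infty_natSinv_lt (PosNum e0).
  by exists n0 => n /hn0 /ltW.
have ucauchy (e : R) : 0 < e -> exists n0, forall m n, (n0 <= m)%N -> (n0 <= n)%N ->
    rnorm (u m - u n) <= e.
  move=> e0; have g0 : 0 < Num.sqrt gamma by rewrite sqrtr_gt0.
  (* Each of the two residuals contributes half of [e * Num.sqrt gamma * s y]; the factor
     [Num.sqrt gamma] pays for passing from the form norm to the norm of [X]. *)
  have [n0 hn0] := small (e * Num.sqrt gamma / 2) ltac:(by rewrite divr_gt0 ?mulr_gt0).
  exists n0 => m n /hn0 hm' /hn0 hn'.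
  have [[Dm um] [Dn un]] := (hu m, hu n).
  have Dy := dom_sub _ _ Dm Dn; set y := u m - u n in Dy *.
  have s0 : 0 <= s y by exact: sqrtr_ge0.
  have s2 := seminorm_sqr _ Dy.
  have qE : q y = Re (a (u m) y - v y) - Re (a (u n) y - v y).
    rewrite /quad {1}/y addrC -scaleN1r form_linl // !ReImE /= !oppr0.
    by rewrite mul0r subr0; lra.
  have : s y ^+ 2 <= e * Num.sqrt gamma * s y.
    have := um y Dy; have := un y Dy.
    have := Re_le_rnorm (a (u m) y - v y); have := Re_le_rnorm (a (u n) y - v y).
    rewrite !ler_norml => /andP[+ _] /andP[_ +].
    rewrite s2 qE.
    have : m.+1%:R^-1 * s y <= e * Num.sqrt gamma / 2 * s y by rewrite ler_wpM2r.
    have : n.+1%:R^-1 * s y <= e * Num.sqrt gamma / 2 * s y by rewrite ler_wpM2r.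
    move: (m.+1%:R^-1 * s y) (n.+1%:R^-1 * s y) => c1 c2.
    lra.
  have e1 : 0 < e * Num.sqrt gamma by rewrite mulr_gt0.
  move=> sle; have {}sle : s y <= e * Num.sqrt gamma.
    by rewrite leNgt; apply/negP => lt; nra.
  rewrite -(ler_pXn2r (ltn0Sn 1)) ?nnegrE ?rnorm_ge0 ?(ltW e0) //.
  rewrite -(ler_pM2l hgamma) (le_trans (form_real _ Dy).2) // -s2.
  rewrite -[gamma in leRHS](sqr_sqrtr (ltW hgamma)) -exprMn mulrC.
  by rewrite ler_pXn2r ?nnegrE ?(ltW e1).
have [l hl] := cauchy_rnorm _ ucauchy.
exists l; split=> // e e0.
have [[n1 h1] [n2 h2]] := (hl e e0, small e e0).
exists (u (maxn n1 n2)); split; first by have [] := hu (maxn n1 n2).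
  exact: h1 (leq_maxl _ _).
move=> y Dy; rewrite (le_trans ((hu _).2 y Dy)) // ler_wpM2r ?sqrtr_ge0 //.
exact: h2 (leq_maxr _ _).
Qed.

End Form.

(** * The operator with this graph, and its self-adjointness *)

Theorem theorem2 (R : realType) (X : completeNormedModType R[i])
  (hX : reflexive_space X) (D0 : set X) (a : X -> X -> R[i])
  (ha : dd_operator D0 a) (hpos : positive_op D0 a)
  (gamma : R) (hgamma : 0 < gamma) (hlb : lower_bound gamma D0 a) :
  exists (D : set X) (A : X -> X -> R[i]),
    [/\ dd_operator D A, positive_op D A, selfadjoint D A,
        extends D0 a D A & lower_bound gamma D A].
Proof.
pose G := @graph R X D0 a.
have GL := graph_lin ha.
have GS := graph_sym ha hgamma hlb.
have GF := graph_functional ha hgamma hlb.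
have G0 u : D0 u -> G u (a u) by exact: graph_form ha u.
pose D := [set u | exists v, G u v].
have /choice[A hA] (u : X) : exists v, D u -> G u v.
  (* Outside [D] the value is arbitrary; [a u] only makes the choice total. *)
  by have [[v Guv]|nD] := pselect (D u); [exists v | exists (a u)].
have D0D : D0 `<=` D by move=> x /G0 Gx; exists (a x).
have GA u v : G u v -> A u = v by move=> Guv; apply: (GF u) => //; apply: hA; exists v.
have Dlin : linear_subspace D.
  split=> [|c x y [v Gxv] [w Gyw]]; first by apply: D0D; case: ha => -[].
  by exists (fun z => c * v z + w z); exact: GL.
have Dadd : dd_operator D A.
  split=> [//|O O0 oO|c x y Dx Dy|x /hA[]//].
    have dD : dense D0 by case: ha.
    by have [x [Ox D0x]] := dD O O0 oO; exists x; split=> //; exact: D0D.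
  by apply: GA; apply: GL; exact: hA.
have Alb : lower_bound gamma D A.
  by move=> x Dx; exact: (graph_lower ha hgamma hlb _ _ (hA x Dx)).
exists D, A; split=> //.
- move=> x Dx; apply: le_trans (Alb x Dx).
  by rewrite mulr_ge0 ?exprn_ge0 // ler0c ltW.
- split=> y; last first.
    by move=> Dy; split=> [|x Dx]; [exact: (hA y Dy).1|rewrite -(GS _ _ _ _ (hA x Dx) (hA y Dy))].
  (* For [y] in [D], symmetry makes [A x y] the conjugate of [A y x], which is bounded in [x]. The
     converse uses surjectivity. *)
  split=> [Dy|cy].
    have /dual_elemP[Ayl [M M0 hM]] := (hA y Dy).1.
    apply: (@bound_within_continuous R X D _ M) => x x' Dx Dx'.
    rewrite (GS _ _ _ _ (hA x Dx) (hA y Dy)) (GS _ _ _ _ (hA x' Dx') (hA y Dy)).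
    by rewrite -rmorphB rnormJ -conjlinB.
  have Alin c x z : D x -> D z -> A (c *: x + z) y = c * A x y + A z y.
    by case: Dadd => _ _ h _ Dx Dz; rewrite h.
  have A0 : A 0 y = 0.
    have := Alin 1 0 0 Dlin.1 Dlin.1; rewrite scale1r add0r mul1r.
    by rewrite -[LHS]addr0 => /addrI.
  have AZ c x : D x -> A (c *: x) y = c * A x y.
    by move=> Dx; have := Alin c x 0 Dx Dlin.1; rewrite A0 !addr0.
  have [||M M0 hM] := within_continuous_bound D (fun x => A x y) Dlin.1 _ _ cy.
  + by move=> r x Dx; rewrite -[_ *: _]addr0; apply: Dlin.2 => //; exact: Dlin.1.
  + by move=> r x; exact: AZ.
  (* Conjugation makes the linear map [x |-> A x y] conjugate-linear, as an element of the dual must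
     be. *)
  have [||w wd hw] := dual_extension D (fun x => (A x y)^*) M Dlin _ M0.
  + by move=> c x z Dx Dz; rewrite Alin // rmorphD rmorphM.
  + by move=> x Dx; rewrite rnormJ hM.
  have [y' Gy'] := graph_surjective ha hgamma hlb w wd.
  suff /subr0_eq -> : y - y' = 0 by exists w.
  (* Writing [v = A x], symmetry gives [v y' = (w x)^* = A x y = v y]. *)
  apply: dual_separates => v vd; have [x Gx] := graph_surjective ha hgamma hlb v vd.
  have Dx : D x by exists v.
  rewrite (conjlinB _ _ _ vd.1) (GS _ _ _ _ Gx Gy') (hw x Dx) -(GA _ _ Gx).
  by rewrite conjcK; exact: subrr.
- by split=> // x D0x; apply: GA; exact: G0.
Qed.
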